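(* Let $\alpha_0,\dots,\alpha_6$ be complex parameters with $\alpha_0+\alpha_1+2\alpha_2+2\alpha_3+2\alpha_4+\alpha_5+\alpha_6=1$, and let $H_1,H_2$ be the polynomial Hamiltonians in $(q_1,p_1,q_2,p_2)$ (depending on $t,s$) given in the context. Set $$K_1:=-H_1+\frac{(\alpha_2\alpha_3+\alpha_2\alpha_6+\alpha_4\alpha_6)\,(\mathrm{Log}(s-t)-\mathrm{Log}(s-1))}{(\alpha_0+\alpha_1+2\alpha_2+2\alpha_3+2\alpha_4+\alpha_5+\alpha_6)(t-1)^2},\qquad K_2:=-H_2.$$ Then $$\{K_1,K_2\}+\frac{\partial K_1}{\partial s}-\frac{\partial K_2}{\partial t}=0,$$ where $\{\,,\,\}$ is the Poisson bracket $$\{L_1,L_2\}=\frac{\partial L_1}{\partial p_1}\frac{\partial L_2}{\partial q_1}-\frac{\partial L_1}{\partial q_1}\frac{\partial L_2}{\partial p_1}+\frac{\partial L_1}{\partial p_2}\frac{\partial L_2}{\partial q_2}-\frac{\partial L_1}{\partial q_2}\frac{\partial L_2}{\partial p_2}.$$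
   Context: The Hamiltonians are $$\begin{aligned}H_1=&\,H_{VI}(q_1,p_1,t,s;\alpha_0,\alpha_1,\alpha_2,\alpha_3+2\alpha_4+\alpha_5,\alpha_3+\alpha_6)\\&+H_{VI}(q_2,p_2,t,s;\alpha_0+2\alpha_2+\alpha_3,\alpha_1+\alpha_3,\alpha_4,\alpha_5,\alpha_6)\\&+\frac{2(q_1-s)q_2\{(q_1-t)p_1+\alpha_2\}\{(q_2-1)p_2+\alpha_4\}}{(\alpha_0+\alpha_1+2\alpha_2+2\alpha_3+2\alpha_4+\alpha_5+\alpha_6)\,t(t-1)(t-s)},\end{aligned}$$ and $H_2=\pi(H_1)$, where $\pi$ is the substitution exchanging $t\leftrightarrow s$ and $\alpha_0\leftrightarrow\alpha_1$. Here $$\begin{aligned}&t(t-1)(t-\eta)H_{VI}(q,p,t,\eta;\beta_0,\dots,\beta_4)\\&=q(q-1)(q-\eta)(q-t)p^2+\{\beta_1(t-\eta)q(q-1)+2\beta_2q(q-1)(q-\eta)+\beta_3(t-1)q(q-\eta)+\beta_4t(q-1)(q-\eta)\}p\\&\quad+\beta_2\{(\beta_1+\beta_2)(t-\eta)+\beta_2(q-1)+\beta_3(t-1)+t\beta_4\}q,\qquad \beta_0+\beta_1+2\beta_2+\beta_3+\beta_4=1.\end{aligned}$$ Partial derivatives in $t,s$ are taken with $q_i,p_i$ held fixed; $\mathrm{Log}$ denotes a (local) branch of the logarithm. *)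

(* Defs.v *)
From Stdlib Require Import Reals.
From Coquelicot Require Export Coquelicot.

Open Scope R_scope.
Open Scope C_scope.

Definition Cexp (z : C) : C :=
  ((exp (Re z) * cos (Im z))%R, (exp (Re z) * sin (Im z))%R).

(* [U] need not be connected, so [L] may follow different branches of the
   logarithm near different points of [U]. *)
Definition is_log_branch (U : C -> Prop) (L : C -> C) : Prop :=
  open U /\ forall z : C, U z -> continuous L z /\ Cexp (L z) = z.

(* [b0] is determined by b0 + b1 + 2 b2 + b3 + b4 = 1 and does not occur in
   the formula. *)
Definition HVI (q p t eta b0 b1 b2 b3 b4 : C) : C :=
  (q * (q - 1) * (q - eta) * (q - t) * p ^ 2
   + (b1 * (t - eta) * q * (q - 1)
      + 2 * b2 * q * (q - 1) * (q - eta)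
      + b3 * (t - 1) * q * (q - eta)
      + b4 * t * (q - 1) * (q - eta)) * p
   + b2 * ((b1 + b2) * (t - eta) + b2 * (q - 1) + b3 * (t - 1) + t * b4) * q)
  / (t * (t - 1) * (t - eta)).

Definition alpha_sum (a0 a1 a2 a3 a4 a5 a6 : C) : C :=
  a0 + a1 + 2 * a2 + 2 * a3 + 2 * a4 + a5 + a6.

Definition H1 (a0 a1 a2 a3 a4 a5 a6 t s q1 p1 q2 p2 : C) : C :=
  HVI q1 p1 t s a0 a1 a2 (a3 + 2 * a4 + a5) (a3 + a6)
  + HVI q2 p2 t s (a0 + 2 * a2 + a3) (a1 + a3) a4 a5 a6
  + 2 * (q1 - s) * q2 * ((q1 - t) * p1 + a2) * ((q2 - 1) * p2 + a4)
    / (alpha_sum a0 a1 a2 a3 a4 a5 a6 * t * (t - 1) * (t - s)).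

(* The substitution pi: it exchanges t with s and a0 with a1. *)
Definition pi_subst {X : Type} (F : C -> C -> C -> C -> C -> C -> C -> C -> C -> X)
    (a0 a1 a2 a3 a4 a5 a6 t s : C) : X :=
  F a1 a0 a2 a3 a4 a5 a6 s t.

Definition H2 : C -> C -> C -> C -> C -> C -> C -> C -> C -> C -> C -> C -> C -> C :=
  pi_subst H1.

Definition K1 (Log : C -> C) (a0 a1 a2 a3 a4 a5 a6 t s q1 p1 q2 p2 : C) : C :=
  - H1 a0 a1 a2 a3 a4 a5 a6 t s q1 p1 q2 p2
  + (a2 * a3 + a2 * a6 + a4 * a6) * (Log (s - t) - Log (s - 1))
    / (alpha_sum a0 a1 a2 a3 a4 a5 a6 * (t - 1) ^ 2).

Definition K2 (a0 a1 a2 a3 a4 a5 a6 t s q1 p1 q2 p2 : C) : C :=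
  - H2 a0 a1 a2 a3 a4 a5 a6 t s q1 p1 q2 p2.

(* Complex differentiability; where it holds, Coquelicot's [C_derive], which is
   computed along real increments only, is the complex derivative. *)
Definition ex_C_derive (f : C -> C) (z : C) : Prop :=
  ex_derive (K := C_AbsRing) (V := C_NormedModule) f z.

Definition ex_partials (L : C -> C -> C -> C -> C) (q1 p1 q2 p2 : C) : Prop :=
  ex_C_derive (fun z => L z p1 q2 p2) q1 /\
  ex_C_derive (fun z => L q1 z q2 p2) p1 /\
  ex_C_derive (fun z => L q1 p1 z p2) q2 /\
  ex_C_derive (fun z => L q1 p1 q2 z) p2.

Definition d_q1 (L : C -> C -> C -> C -> C) (q1 p1 q2 p2 : C) : C :=
  C_derive (fun z => L z p1 q2 p2) q1.
Definition d_p1 (L : C -> C -> C -> C -> C) (q1 p1 q2 p2 : C) : C :=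
  C_derive (fun z => L q1 z q2 p2) p1.
Definition d_q2 (L : C -> C -> C -> C -> C) (q1 p1 q2 p2 : C) : C :=
  C_derive (fun z => L q1 p1 z p2) q2.
Definition d_p2 (L : C -> C -> C -> C -> C) (q1 p1 q2 p2 : C) : C :=
  C_derive (fun z => L q1 p1 q2 z) p2.

Definition poisson (L1 L2 : C -> C -> C -> C -> C) (q1 p1 q2 p2 : C) : C :=
  d_p1 L1 q1 p1 q2 p2 * d_q1 L2 q1 p1 q2 p2
  - d_q1 L1 q1 p1 q2 p2 * d_p1 L2 q1 p1 q2 p2
  + d_p2 L1 q1 p1 q2 p2 * d_q2 L2 q1 p1 q2 p2
  - d_q2 L1 q1 p1 q2 p2 * d_p2 L2 q1 p1 q2 p2.

(* Main.v *)
Require Import Defs.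
From Stdlib Require Import Reals Lra.
From Coquelicot Require Import Coquelicot.

(** Write [c] for [a2 * a3 + a2 * a6 + a4 * a6].  When the weighted sum of the
    parameters is 1, the two Hamiltonians of the coupled Painleve VI system
    satisfy the zero-curvature equation up to a term free of the [q]'s and
    [p]'s:
    [{H1, H2} - dH1/ds + dH2/dt = - c / ((s - t) (s - 1) (t - 1))].
    Both sides are rational functions, so this is a polynomial identity in [q1],
    [p1], [q2], [p2], [t], [s] and the parameters once the denominators
    [t (t - 1) (t - s)] and [s (s - 1) (s - t)] are cleared.  The logarithmic
    term of [K1] does not affect the Poisson bracket, and its derivative in [s],
    [c (1 / (s - t) - 1 / (s - 1)) / (t - 1) ^ 2], equals
    [c / ((s - t) (s - 1) (t - 1))], which is exactly the defect.

    What has to be justified analytically is that every partial derivative is a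
    complex derivative with the value given by the usual rules.  The only
    transcendental input is [L' (z) = 1 / z] for a continuous branch [L] of the
    logarithm ([is_C_derive_log_branch]).  It follows from two general facts:
    a pair of real-differentiable functions satisfying the Cauchy-Riemann
    equations is complex differentiable ([is_C_derive_Cauchy_Riemann]), which
    gives [Cexp' = Cexp]; and a continuous right inverse of a function with
    nonzero derivative is differentiable ([is_C_derive_inverse]). *)

(** * Complex derivatives *)

(** The normed-module structure on the target is fixed here because two of them
    exist on [C], the product structure and the one induced by the absolute
    ring; they share the norm [Cmod] but not the uniform structure. *)
Local Notation is_C_derive := (@is_derive C_AbsRing C_NormedModule).

Lemma is_linear_C_scal (l : C) :
  is_linear (K := C_AbsRing) (U := AbsRing_NormedModule C_AbsRing)
    (V := C_NormedModule) (fun y : C => (y * l)%C).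
Proof.
split.
- intros x y. exact (Cmult_plus_distr_r x y l).
- intros k x. exact (eq_sym (Cmult_assoc k x l)).
- exists (Cmod l + 1)%R. split.
  + generalize (Cmod_ge_0 l); lra.
  + intros x. change (Cmod (x * l) <= (Cmod l + 1) * Cmod x)%R.
    rewrite Cmod_mult. generalize (Cmod_ge_0 x); nra.
Qed.

(** The neighbourhood filter in [is_C_derive] is by definition that of the discs
    for [Cmod], so estimates on [Cmod] suffice. *)
Lemma is_C_derive_eps (f : C -> C) (z l : C) :
  is_C_derive f z l <->
  forall eps : posreal, exists delta : posreal, forall w : C,
    (Cmod (w - z) < delta)%R ->
    (Cmod (f w - f z - (w - z) * l) <= eps * Cmod (w - z))%R.
Proof.
split.
- intros [_ H]. exact (H z (fun P HP => HP)).
- intros H. split; [ exact (is_linear_C_scal l) |].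
  intros x Hx.
  replace x with z.
  + exact H.
  + exact (is_filter_lim_locally_unique (V := AbsRing_NormedModule C_AbsRing) z x Hx).
Qed.

(** Passing to the absolute-ring structure gives access to the product and
    chain rules, which are stated for functions with values in a ring. *)
Lemma is_C_derive_AbsRing (f : C -> C) (z l : C) :
  is_C_derive f z l <->
  is_derive (K := C_AbsRing) (V := AbsRing_NormedModule C_AbsRing) f z l.
Proof.
split; intros [[Hplus Hscal Hnorm] Hdomin];
  (split; [ split; [ exact Hplus | exact Hscal | exact Hnorm ] | exact Hdomin ]).
Qed.

(** Continuity, unlike differentiability, is phrased with the product uniform
    structure; its neighbourhoods are also those given by discs. *)
Lemma locally_Cmod (z : C) (P : C -> Prop) :
  locally (T := C_UniformSpace) z P <->
  exists delta : posreal, forall w : C, (Cmod (w - z) < delta)%R -> P w.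
Proof. exact (locally_C z P). Qed.

(** * Rules of differentiation *)

Lemma is_C_derive_const (a z : C) : is_C_derive (fun _ => a) z (0%R : C).
Proof. exact (is_derive_const (V := C_NormedModule) a z). Qed.

Lemma is_C_derive_id (z : C) : is_C_derive (fun w => w) z (1%R : C).
Proof.
apply is_C_derive_eps. intros eps. exists eps. intros w _.
replace (w - z - (w - z) * 1%R)%C with (0%R : C) by ring.
rewrite Cmod_0. apply Rmult_le_pos; [ apply Rlt_le, cond_pos | apply Cmod_ge_0 ].
Qed.

Lemma is_C_derive_plus (f g : C -> C) (z df dg : C) :
  is_C_derive f z df -> is_C_derive g z dg ->
  is_C_derive (fun w => f w + g w)%C z (df + dg)%C.
Proof. exact (is_derive_plus (V := C_NormedModule) f g z df dg). Qed.

Lemma is_C_derive_opp (f : C -> C) (z df : C) :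
  is_C_derive f z df -> is_C_derive (fun w => - f w)%C z (- df)%C.
Proof. exact (is_derive_opp (V := C_NormedModule) f z df). Qed.

Lemma is_C_derive_minus (f g : C -> C) (z df dg : C) :
  is_C_derive f z df -> is_C_derive g z dg ->
  is_C_derive (fun w => f w - g w)%C z (df - dg)%C.
Proof. exact (is_derive_minus (V := C_NormedModule) f g z df dg). Qed.

Lemma is_C_derive_mult (f g : C -> C) (z df dg : C) :
  is_C_derive f z df -> is_C_derive g z dg ->
  is_C_derive (fun w => f w * g w)%C z (df * g z + f z * dg)%C.
Proof.
rewrite !is_C_derive_AbsRing. intros Hf Hg.
exact (is_derive_mult f g z df dg Hf Hg Cmult_comm).
Qed.

Lemma is_C_derive_sqr (f : C -> C) (z df : C) :
  is_C_derive f z df -> is_C_derive (fun w => f w ^ 2)%C z (2%R * f z * df)%C.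
Proof.
intros H.
replace (2%R * f z * df)%C
  with (df * (f z * 1%R) + f z * (df * 1%R + f z * 0%R))%C by ring.
apply (is_C_derive_mult f (fun w => f w * 1%R)%C); [ exact H |].
apply (is_C_derive_mult f (fun _ => 1%R : C)); [ exact H |].
apply is_C_derive_const.
Qed.

Lemma is_C_derive_comp (f g : C -> C) (z df dg : C) :
  is_C_derive f (g z) df -> is_C_derive g z dg ->
  is_C_derive (fun w => f (g w)) z (dg * df)%C.
Proof.
intros Hf Hg. apply is_C_derive_AbsRing in Hg.
exact (is_derive_comp (V := C_NormedModule) f g z df dg Hf Hg).
Qed.

(** The error of the linear approximation is exactly
    [(w - z) ^ 2 / (z ^ 2 * w)].  It is at most
    [2 |w - z| ^ 2 / |z| ^ 3], since [|w| >= |z| / 2] near [z]. *)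
Lemma is_C_derive_inv (z : C) :
  z <> 0%R -> is_C_derive (fun w => / w)%C z (- / z ^ 2)%C.
Proof.
intros Hz. apply is_C_derive_eps. intros eps.
pose proof (proj1 (Cmod_gt_0 z) Hz) as Hz'.
pose proof (cond_pos eps) as Heps.
assert (Hd : (0 < Rmin (Cmod z / 2) (eps * Cmod z ^ 3 / 2))%R).
{ apply Rmin_pos; [ lra |].
  apply Rdiv_lt_0_compat; [ apply Rmult_lt_0_compat; [ lra | now apply pow_lt ] | lra ]. }
exists (mkposreal _ Hd). cbn [pos]. intros w Hw.
pose proof (Rlt_le_trans _ _ _ Hw (Rmin_l _ _)) as Hw1.
pose proof (Rlt_le_trans _ _ _ Hw (Rmin_r _ _)) as Hw2.
assert (Hhalf : (Cmod z / 2 <= Cmod w)%R).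
{ pose proof (Cmod_triangle w (- (w - z))) as T.
  rewrite Cmod_opp in T. replace (w + - (w - z))%C with z in T by ring. lra. }
assert (Hw0 : w <> 0%R). { apply Cmod_gt_0. lra. }
replace (/ w - / z - (w - z) * - / z ^ 2)%C
  with ((w - z) * (w - z) / (z ^ 2 * w))%C by (field; split; assumption).
rewrite Cmod_div, !Cmod_mult, Cmod_pow
  by (apply Cmult_neq_0; [ apply Cpow_nz |]; assumption).
pose proof (Cmod_ge_0 (w - z)) as Hh.
apply Rle_div_l.
- apply Rmult_gt_0_compat; [ now apply pow_lt | lra ].
- replace (eps * Cmod (w - z) * (Cmod z ^ 2 * Cmod w))%R
    with ((eps * Cmod z ^ 2 * Cmod w) * Cmod (w - z))%R by ring.
  apply Rmult_le_compat_r; [ assumption |].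
  apply Rle_trans with (eps * Cmod z ^ 2 * (Cmod z / 2))%R; [ lra |].
  apply Rmult_le_compat_l; [| assumption ].
  apply Rmult_le_pos; [ lra | now apply Rlt_le, pow_lt ].
Qed.

Lemma is_C_derive_div (f g : C -> C) (z df dg : C) :
  is_C_derive f z df -> is_C_derive g z dg -> g z <> 0%R ->
  is_C_derive (fun w => f w / g w)%C z ((df * g z - f z * dg) / g z ^ 2)%C.
Proof.
intros Hf Hg Hz.
replace ((df * g z - f z * dg) / g z ^ 2)%C
  with (df * / g z + f z * (dg * (- / g z ^ 2)))%C by (field; exact Hz).
apply (is_C_derive_mult f (fun w => / g w)%C); [ exact Hf |].
apply (is_C_derive_comp Cinv); [ now apply is_C_derive_inv | exact Hg ].
Qed.

(** The differentiability of [f] at [g z] bounds [|w - z - (g w - g z) l|] by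
    [eta |g w - g z|]; with [eta <= |l| / 2] this makes [g] Lipschitz at [z],
    so the bound becomes one in terms of [|w - z|]. *)
Lemma is_C_derive_inverse (f g : C -> C) (z l : C) :
  is_C_derive f (g z) l -> l <> 0%R ->
  continuous g z -> locally z (fun w => f (g w) = w) ->
  is_C_derive g z (/ l)%C.
Proof.
intros Hf Hl Hg Hfg.
rewrite is_C_derive_eps in Hf |- *. intros eps.
pose proof (proj1 (Cmod_gt_0 l) Hl) as Hl'.
pose proof (cond_pos eps) as Heps.
(* [eta]: the first bound gives the Lipschitz constant [2 / |l|], the second one
   compensates for it and for the final division by [l]. *)
assert (Heta : (0 < Rmin (Cmod l / 2) (eps * Cmod l ^ 2 / 2))%R).
{ apply Rmin_pos; [ lra |].
  apply Rdiv_lt_0_compat; [ apply Rmult_lt_0_compat; [ lra | now apply pow_lt ] | lra ]. }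
destruct (Hf (mkposreal _ Heta)) as [d1 H1]. cbn [pos] in H1.
assert (H2 : locally z (fun w => (Cmod (g w - g z) < d1)%R)).
{ apply (Hg (fun y => (Cmod (y - g z) < d1)%R)). apply locally_Cmod. now exists d1. }
destruct (proj1 (locally_Cmod _ _) (filter_and _ _ Hfg H2)) as [d Hd].
pose proof (locally_singleton _ _ Hfg) as Hz. cbv beta in Hz.
exists d. intros w Hw. destruct (Hd w Hw) as [Ew Bw].
specialize (H1 (g w) Bw). rewrite Ew, Hz in H1.
pose proof (Cmod_ge_0 (g w - g z)) as Pg.
assert (Hlip : (Cmod (g w - g z) <= 2 / Cmod l * Cmod (w - z))%R).
{ pose proof (Cmod_triangle (w - z) (- (w - z - (g w - g z) * l))) as T.
  rewrite Cmod_opp in T.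
  replace (w - z + - (w - z - (g w - g z) * l))%C with ((g w - g z) * l)%C in T by ring.
  rewrite Cmod_mult in T.
  pose proof (Rmult_le_compat_r _ _ _ Pg (Rmin_l (Cmod l / 2) (eps * Cmod l ^ 2 / 2))) as B.
  apply Rmult_le_reg_l with (Cmod l); [ assumption |].
  replace (Cmod l * (2 / Cmod l * Cmod (w - z)))%R with (2 * Cmod (w - z))%R by (field; lra).
  lra. }
replace (g w - g z - (w - z) * / l)%C
  with (- (w - z - (g w - g z) * l) / l)%C by (field; assumption).
rewrite Cmod_div, Cmod_opp by assumption.
apply Rle_div_l; [ assumption |].
apply (Rle_trans _ _ _ H1).
apply Rle_trans with (eps * Cmod l ^ 2 / 2 * (2 / Cmod l * Cmod (w - z)))%R.
- apply Rmult_le_compat; [ lra | assumption | apply Rmin_r | assumption ].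
- apply Req_le. field. lra.
Qed.

(** * The exponential and the branches of the logarithm *)

(** Under the Cauchy-Riemann equations the real differentials of [u] and [v]
    combine into multiplication by [a + i b], and the real errors, measured with
    [Rmax], are controlled because [Rmax |Re h| |Im h| <= |h|]. *)
Lemma is_C_derive_Cauchy_Riemann (u v : R -> R -> R) (x y a b : R) :
  differentiable_pt_lim u x y a (- b) ->
  differentiable_pt_lim v x y b a ->
  is_C_derive (fun z => (u (Re z) (Im z), v (Re z) (Im z))) (x, y) (a, b).
Proof.
intros Hu Hv. apply is_C_derive_eps. intros eps.
destruct (Hu (pos_div_2 eps)) as [d1 H1].
destruct (Hv (pos_div_2 eps)) as [d2 H2].
assert (Hd : (0 < Rmin d1 d2)%R) by (apply Rmin_pos; apply cond_pos).
exists (mkposreal _ Hd). cbn [pos]. intros [w1 w2] Hw.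
pose proof (Rmax_Cmod ((w1, w2) - (x, y))%C : Rmax (Rabs (w1 - x)) (Rabs (w2 - y)) <= _)%R as M.
set (n := Cmod ((w1, w2) - (x, y))%C) in *.
pose proof (Rmax_l (Rabs (w1 - x)) (Rabs (w2 - y))) as M1.
pose proof (Rmax_r (Rabs (w1 - x)) (Rabs (w2 - y))) as M2.
pose proof (Rmin_l d1 d2) as D1. pose proof (Rmin_r d1 d2) as D2.
specialize (H1 w1 w2 ltac:(lra) ltac:(lra)).
specialize (H2 w1 w2 ltac:(lra) ltac:(lra)).
simpl in H1, H2.
(* The complex error splits into [error of u + i * error of v], each at most
   [eps / 2] times [|w - z|]. *)
match goal with |- (Cmod ?c <= _)%R =>
  replace c with
    (((u w1 w2 - u x y - (a * (w1 - x) + - b * (w2 - y)))%R : C)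
     + Ci * ((v w1 w2 - v x y - (b * (w1 - x) + a * (w2 - y)))%R : C))%C
    by (apply injective_projections; simpl; ring)
end.
eapply Rle_trans; [ apply Cmod_triangle |].
rewrite Cmod_mult, Cmod_Ci, !Cmod_R.
pose proof (cond_pos eps).
pose proof (Rmult_le_compat_l (eps / 2) _ _ ltac:(lra) M).
lra.
Qed.

(** The real and imaginary parts of the exponential are products of this shape. *)
Lemma differentiable_pt_lim_mult_sep (f g : R -> R) (x y df dg : R) :
  is_derive f x df -> is_derive g y dg ->
  differentiable_pt_lim (fun u v => f u * g v)%R x y (df * g y) (f x * dg).
Proof.
intros Hf Hg.
set (R2 := prod_NormedModule R_AbsRing R_NormedModule R_NormedModule).
apply (filterdiff_differentiable_pt_lim (fun u v => f u * g v)%R).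
eapply filterdiff_ext_lin.
- apply (filterdiff_mult_fct (K := R_AbsRing) (U := R2)
    (fun u => f (fst u)) (fun u => g (snd u)) (x, y)).
  + exact Rmult_comm.
  + apply (filterdiff_comp' (U := R2) fst f);
      [ apply filterdiff_linear, is_linear_fst | exact Hf ].
  + apply (filterdiff_comp' (U := R2) snd g);
      [ apply filterdiff_linear, is_linear_snd | exact Hg ].
- intros [u v]. simpl. unfold plus, mult, scal; simpl. unfold mult; simpl. ring.
Qed.

Lemma is_C_derive_Cexp (z : C) : is_C_derive Cexp z (Cexp z).
Proof.
destruct z as [x y].
apply (is_C_derive_Cauchy_Riemann
  (fun u v => exp u * cos v)%R (fun u v => exp u * sin v)%R x y).
- simpl. replace (- (exp x * sin y))%R with (exp x * - sin y)%R by ring.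
  apply differentiable_pt_lim_mult_sep;
    [ apply is_derive_exp | apply is_derive_cos ].
- apply (differentiable_pt_lim_mult_sep exp sin);
    [ apply is_derive_exp | apply is_derive_sin ].
Qed.

Lemma Cexp_neq_0 (z : C) : Cexp z <> 0%R.
Proof.
unfold Cexp. intros E. injection E as Ecos Esin.
pose proof (exp_pos (Re z)) as Hexp.
pose proof (sin2_cos2 (Im z)) as H. unfold Rsqr in H.
apply Rmult_integral in Ecos. apply Rmult_integral in Esin.
destruct Ecos as [Ecos | Ecos]; [ lra |].
destruct Esin as [Esin | Esin]; [ lra |].
rewrite Ecos, Esin in H. lra.
Qed.

Lemma is_C_derive_log_branch (U : C -> Prop) (L : C -> C) (z : C) :
  is_log_branch U L -> U z -> is_C_derive L z (/ z)%C.
Proof.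
intros [HU HL] Hz.
destruct (HL z Hz) as [Hcont Hexp].
apply (is_C_derive_inverse Cexp).
- rewrite <- Hexp at 2. apply is_C_derive_Cexp.
- rewrite <- Hexp. apply Cexp_neq_0.
- exact Hcont.
- apply (filter_imp U); [| exact (HU z Hz) ].
  intros w Hw. exact (proj2 (HL w Hw)).
Qed.

(** * The zero-curvature equation *)

Lemma Cminus_neq_0 (x y : C) : x <> y -> (x - y)%C <> 0%R.
Proof.
intros H E. apply H. replace x with (x - y + y)%C by ring. rewrite E. ring.
Qed.

Ltac C_nonzero :=
  repeat apply Cmult_neq_0; auto using Cminus_neq_0, C1_nz.

(** Differentiates a function built from rational operations and from functions
    whose derivatives are hypotheses; the derivative may be an evar.  Unification
    leaves partial applications [op c] for [fun w => op c w], which the last case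
    eta-expands so that the other cases recognize them. *)
Ltac derive_C :=
  lazymatch goal with
  | |- is_derive (fun _ => ?a) _ _ => apply is_C_derive_const
  | |- is_derive (fun w => w) _ _ => apply is_C_derive_id
  | |- is_derive (fun w => Cplus _ _) _ _ => eapply is_C_derive_plus; derive_C
  | |- is_derive (fun w => Cminus _ _) _ _ => eapply is_C_derive_minus; derive_C
  | |- is_derive (fun w => Copp _) _ _ => eapply is_C_derive_opp; derive_C
  | |- is_derive (fun w => Cmult _ _) _ _ => eapply is_C_derive_mult; derive_C
  | |- is_derive (fun w => Cpow _ 2) _ _ => eapply is_C_derive_sqr; derive_C
  | |- is_derive (fun w => Cdiv _ _) _ _ =>
      eapply is_C_derive_div; [ derive_C | derive_C | C_nonzero ]
  | |- is_derive (fun w => ?f (@?g w)) _ _ =>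
      eapply (is_C_derive_comp f g); [ eassumption | derive_C ]
  | |- is_derive (?op ?c) ?z ?l =>
      change (is_C_derive (fun w => op c w) z l); derive_C
  end.

Theorem proposition3p1
    (a0 a1 a2 a3 a4 a5 a6 : C)
    (Halpha : alpha_sum a0 a1 a2 a3 a4 a5 a6 = 1%R)
    (U : C -> Prop) (Log : C -> C) (HLog : is_log_branch U Log)
    (t s : C)
    (Ht0 : t <> 0%R) (Ht1 : t <> 1%R) (Hs0 : s <> 0%R) (Hs1 : s <> 1%R)
    (Hts : t <> s)
    (Hst : U (s - t)%C) (Hs1U : U (s - 1)%C)
    (q1 p1 q2 p2 : C) :
  let k1 := K1 Log a0 a1 a2 a3 a4 a5 a6 in
  let k2 := K2 a0 a1 a2 a3 a4 a5 a6 in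
  ex_partials (k1 t s) q1 p1 q2 p2 /\
  ex_partials (k2 t s) q1 p1 q2 p2 /\
  ex_C_derive (fun s' => k1 t s' q1 p1 q2 p2) s /\
  ex_C_derive (fun t' => k2 t' s q1 p1 q2 p2) t /\
  (poisson (k1 t s) (k2 t s) q1 p1 q2 p2
   + C_derive (fun s' => k1 t s' q1 p1 q2 p2) s
   - C_derive (fun t' => k2 t' s q1 p1 q2 p2) t)%C = 0%R.
Proof.
intros k1 k2.
assert (Halpha' : alpha_sum a1 a0 a2 a3 a4 a5 a6 = 1%R).
{ rewrite <- Halpha. unfold alpha_sum. ring. }
pose proof (is_C_derive_log_branch _ _ _ HLog Hst) as HLog_st.
pose proof (is_C_derive_log_branch _ _ _ HLog Hs1U) as HLog_s1.
(* The normalization is used before differentiating, so that the denominators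
   are products of factors among [1], [t], [s], [t - 1], [s - 1] and
   [+- (t - s)], whose nonvanishing is assumed. *)
eassert (D1q1 : is_C_derive (fun z : C => K1 Log a0 a1 a2 a3 a4 a5 a6 t s z p1 q2 p2) q1 _)
  by (unfold K1, H1, HVI; rewrite Halpha; derive_C).
eassert (D1p1 : is_C_derive (fun z : C => K1 Log a0 a1 a2 a3 a4 a5 a6 t s q1 z q2 p2) p1 _)
  by (unfold K1, H1, HVI; rewrite Halpha; derive_C).
eassert (D1q2 : is_C_derive (fun z : C => K1 Log a0 a1 a2 a3 a4 a5 a6 t s q1 p1 z p2) q2 _)
  by (unfold K1, H1, HVI; rewrite Halpha; derive_C).
eassert (D1p2 : is_C_derive (fun z : C => K1 Log a0 a1 a2 a3 a4 a5 a6 t s q1 p1 q2 z) p2 _)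
  by (unfold K1, H1, HVI; rewrite Halpha; derive_C).
eassert (D2q1 : is_C_derive (fun z : C => K2 a0 a1 a2 a3 a4 a5 a6 t s z p1 q2 p2) q1 _)
  by (unfold K2, H2, pi_subst, H1, HVI; rewrite Halpha'; derive_C).
eassert (D2p1 : is_C_derive (fun z : C => K2 a0 a1 a2 a3 a4 a5 a6 t s q1 z q2 p2) p1 _)
  by (unfold K2, H2, pi_subst, H1, HVI; rewrite Halpha'; derive_C).
eassert (D2q2 : is_C_derive (fun z : C => K2 a0 a1 a2 a3 a4 a5 a6 t s q1 p1 z p2) q2 _)
  by (unfold K2, H2, pi_subst, H1, HVI; rewrite Halpha'; derive_C).
eassert (D2p2 : is_C_derive (fun z : C => K2 a0 a1 a2 a3 a4 a5 a6 t s q1 p1 q2 z) p2 _)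
  by (unfold K2, H2, pi_subst, H1, HVI; rewrite Halpha'; derive_C).
eassert (D1s : is_C_derive (fun z : C => K1 Log a0 a1 a2 a3 a4 a5 a6 t z q1 p1 q2 p2) s _)
  by (unfold K1, H1, HVI; rewrite Halpha; derive_C).
eassert (D2t : is_C_derive (fun z : C => K2 a0 a1 a2 a3 a4 a5 a6 z s q1 p1 q2 p2) t _)
  by (unfold K2, H2, pi_subst, H1, HVI; rewrite Halpha'; derive_C).
split; [| split; [| split; [| split ] ] ].
- repeat split; eexists; eassumption.
- repeat split; eexists; eassumption.
- eexists; exact D1s.
- eexists; exact D2t.
- unfold poisson, d_q1, d_p1, d_q2, d_p2, k1, k2.
  rewrite (is_C_derive_unique _ _ _ D1q1), (is_C_derive_unique _ _ _ D1p1),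
    (is_C_derive_unique _ _ _ D1q2), (is_C_derive_unique _ _ _ D1p2),
    (is_C_derive_unique _ _ _ D2q1), (is_C_derive_unique _ _ _ D2p1),
    (is_C_derive_unique _ _ _ D2q2), (is_C_derive_unique _ _ _ D2p2),
    (is_C_derive_unique _ _ _ D1s), (is_C_derive_unique _ _ _ D2t).
  clear - Halpha Ht0 Ht1 Hs0 Hs1 Hts.
  (* Once [a0] is eliminated through the normalization of the parameters, both
     sides are equal as rational functions of independent variables. *)
  assert (Ha0 : a0 = (1 - a1 - 2 * a2 - 2 * a3 - 2 * a4 - a5 - a6)%C).
  { rewrite <- Halpha. unfold alpha_sum. ring. }
  subst a0. field. repeat split; auto using Cminus_neq_0.
Qed.
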